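(* Let $(M,d)$ be a compact metric space. Let $\nu$ be a Borel probability measure on $C(M)$ whose topological support $\mathcal{G}$ is $\varrho_\infty$-bounded. Assume that the random dynamical system induced by $\nu$ is weakly contracting on average, i.e. $\lambda_\nu<\infty$. Let $\eta$ be the (unique) $\nu$-stationary probability measure on $M$. Then, for every Lipschitz function $h:M\to\mathbb{R}$, every $x\in M$, all $n\in\mathbb{N}$, and all $t>\frac{2\lambda_\nu\operatorname{L}(h)}{n}$, $$\mathbb{P}\left(\left|\frac1nS_n^x(h)-\eta(h)\right|>t\right)\le2\exp\left(-\frac{nt^2}{48\operatorname{L}(h)^2(\lambda_\nu+|\mathcal{G}|_\infty)^2}\right).$$ Moreover, $$\lim_{n\to\infty}\sup_{x\in M}\left|\frac1n\mathbb{E}\left[S_n^x(h)\right]-\eta(h)\right|=0.$$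
   Context: $C(M)$ is the space of continuous maps $M\to M$ with the metric $\varrho_\infty(f,g)=\sup_{x\in M}d(f(x),g(x))$; $|\mathcal{G}|_\infty=\sup_{f,g\in\mathcal{G}}\varrho_\infty(f,g)$, and $\mathcal{G}$ is $\varrho_\infty$-bounded if this is finite. $(\Omega,\mathbb{P})=(\mathcal{G}^{\mathbb{N}},\nu^{\mathbb{N}})$, with expectation $\mathbb{E}$; for $\omega=(f_1,f_2,\dots)$, $X_n^x[\omega]=f_n\circ\cdots\circ f_1(x)$, $X_0^x=x$. $\lambda_\nu=\sup_{x,y\in M}\sum_{n=0}^\infty\mathbb{E}[d(X_n^x,X_n^y)]$. A Borel probability measure $\eta$ on $M$ is $\nu$-stationary if $\eta(A)=\int_{\mathcal{G}}\eta(f^{-1}A)\,d\nu(f)$ for all Borel $A\subset M$. $S_n^x(h)=\sum_{k=0}^{n-1}h(X_k^x)$, $\eta(h)=\int_Mh\,d\eta$, and $\operatorname{L}(h)=\sup_{x\ne x'}\frac{|h(x)-h(x')|}{d(x,x')}$. *)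

(* Defs.v *)
(* MathComp-Analysis, over an arbitrary [R : realType] *)
From HB Require Import structures.
From mathcomp Require Import all_boot all_order all_algebra.
From mathcomp Require Import all_classical all_reals all_analysis.

Set Implicit Arguments.
Unset Strict Implicit.
Unset Printing Implicit Defensive.

Import Order.TTheory GRing.Theory Num.Theory.
Import numFieldNormedType.Exports.

Local Open Scope classical_set_scope.
Local Open Scope ring_scope.

(* [measurableType] requires a base point, hence nonempty metric spaces. *)
#[short(type="pointedMetricType")]
HB.structure Definition PointedMetric (R : numDomainType) :=
  {M of Pointed M & Metric R M}.

Notation borel T := (g_sigma_algebraType (@open T)).

(* The alias carries the topology of uniform convergence. *)
Definition selfmap (R : realType) (M : pointedMetricType R) : Type :=
  continuousType M M.

Section SelfMaps.
Context (R : realType) (M : pointedMetricType R).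

Definition selfmap_fun (f : selfmap M) : M -> M := (f : continuousType M M).
Local Coercion selfmap_fun : selfmap >-> Funclass.

HB.instance Definition _ := gen_eqMixin (selfmap M).
HB.instance Definition _ := gen_choiceMixin (selfmap M).
HB.instance Definition _ :=
  isPointed.Build (selfmap M) ((idfun : M -> M) : continuousType M M).

(* Extended-real valued, so that it defines a topology without assuming that
   [M] is bounded; it is finite when [M] is compact. *)
Definition rho_sup (f g : selfmap M) : \bar R :=
  ereal_sup [set (mdist (f x) (g x))%:E | x in [set: M]].

Let sball (f : selfmap M) (e : R) : set (selfmap M) :=
  [set g | (rho_sup f g < e%:E)%E].

Let sent : set_system (selfmap M * selfmap M) := entourage_ sball.
Let snbhs (f : selfmap M) : set_system (selfmap M) := nbhs_ sent f.
Let snbhsE : snbhs = nbhs_ sent. Proof. by []. Qed.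

HB.instance Definition _ := hasNbhs.Build (selfmap M) snbhs.

Let sball_center f (e : R) : 0 < e -> sball f e f.
Proof.
move=> e0; apply: (@le_lt_trans _ _ 0%E); last by rewrite lte_fin.
by apply: ge_ereal_sup => _ [x _ <-]; rewrite mdistxx.
Qed.

Let sball_sym f g (e : R) : sball f e g -> sball g e f.
Proof.
rewrite /sball /= /rho_sup; under eq_fun do rewrite metric_sym.
by [].
Qed.

Let sball_triangle f g k e1 e2 : sball f e1 g -> sball g e2 k ->
  sball f (e1 + e2) k.
Proof.
rewrite /sball /= => fg gk; apply: le_lt_trans (lteD fg gk).
apply: ge_ereal_sup => _ [x _ <-].
apply: (@le_trans _ _ ((mdist (f x) (g x))%:E + (mdist (g x) (k x))%:E)%E).
  by rewrite -EFinD lee_fin metric_triangle.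
by apply: leeD; apply: ereal_sup_ubound; exists x.
Qed.

Let sentE : sent = entourage_ sball. Proof. by []. Qed.

HB.instance Definition _ := @Nbhs_isPseudoMetric.Build R (selfmap M)
  sent snbhsE sball sball_center sball_sym sball_triangle sentE.

End SelfMaps.

Coercion selfmap_fun : selfmap >-> Funclass.

Section RandomDynamics.
Context (R : realType) (M : pointedMetricType R).
Implicit Types (nu : probability (borel (selfmap M)) R)
  (eta : probability (borel M) R) (h : M -> R).
Local Open Scope ereal_scope.

Definition topsupport nu : set (selfmap M) :=
  [set f | forall U : set (selfmap M), open U -> U f -> 0 < nu U].

Definition rho_diam (G : set (selfmap M)) : \bar R :=
  ereal_sup [set rho_sup f g | f in G & g in G].

Definition cylinders : set (set (nat -> borel (selfmap M))) :=
  [set B | exists (i : nat) (A : set (borel (selfmap M))),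
    measurable A /\ B = [set w | A (w i)]].

(* Sequences (f_1, f_2, ...), with f_(i+1) stored at index i. All sequences in
   C(M) are allowed: [nu] is carried by its support, C(M) being separable when
   [M] is compact, so the product measure is carried by the sequences with
   entries in the support. *)
Local Notation mapseq := (g_sigma_algebraType cylinders).

(* This determines [P], the finite-dimensional measurable boxes being a
   pi-system that generates the sigma-algebra. *)
Definition is_power_measure nu (P : probability mapseq R) : Prop :=
  forall (n : nat) (A : nat -> set (borel (selfmap M))),
    (forall i, measurable (A i)) ->
    P [set w | forall i, (i < n)%N -> A i (w i)] = \prod_(i < n) nu (A i).

Fixpoint orbit (w : mapseq) (n : nat) (x : M) : M :=
  if n is k.+1 then (w k : selfmap M) (orbit w k x) else x.

Definition contraction_sum (P : probability mapseq R) : \bar R :=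
  ereal_sup [set \sum_(0 <= n <oo)
      'E_P[fun w => mdist (orbit w n xy.1) (orbit w n xy.2)]
    | xy in [set: M * M]].

Definition stationary nu eta : Prop :=
  forall A : set (borel M), measurable A ->
    eta A = \int[nu]_(f in topsupport nu) eta ((f : selfmap M) @^-1` A).

Definition birkhoff_sum h (n : nat) (x : M) (w : mapseq) : R :=
  (\sum_(k < n) h (orbit w k x))%R.

Definition mean eta h : R := (\int[eta]_x h x)%R.

Definition is_lipschitz h : Prop :=
  exists K : R, forall x x', (`|h x - h x'| <= K * mdist x x')%R.

(* On a one-point space this is [sup set0 = 0]. *)
Definition lipschitz_const h : R :=
  sup [set (`|h p.1 - h p.2| / mdist p.1 p.2)%R
      | p in [set p : M * M | p.1 != p.2]].

End RandomDynamics.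

Notation mapseq M := (g_sigma_algebraType (@cylinders _ M)).

(* Main.v *)
(** Write [c] for the product of the Lipschitz constant of [h] and the
    contraction sum, and [V n x] for the mean of the Birkhoff sum [S_n^x].
    Summing [|h (X_k^x) - h (X_k^y)|] shows that [V n] oscillates by at most
    [c]. Splitting off the first map gives [V (n+1) x = h x + E (V n (f x))], so
    [S_(n+1)^x - V (n+1) x] is the centred variable [V n (f x) - E (V n (f x))],
    bounded by [c], plus a copy of [S_n - V n] restarted at [f x]. With
    [exp z <= z + exp (2 z^2)] this yields
    [E exp (s (S_n^x - V n x)) <= exp (2 n s^2 c^2)] by induction on [n], and
    Chernoff's bound controls the deviation of [S_n^x] from [V n x]. By
    stationarity [V n] has [eta]-mean [n eta(h)], so [V n x] is within [c] of
    [n eta(h)], and [c < n t / 2] by the hypothesis on [t]. *)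

Require Import Defs.
From HB Require Import structures.
From mathcomp Require Import all_boot all_order all_algebra.
From mathcomp Require Import all_classical all_reals all_analysis.
From mathcomp Require Import measurable_realfun.
From mathcomp Require Import ring lra.
Import Order.TTheory GRing.Theory Num.Theory.
Import numFieldNormedType.Exports.
Set Implicit Arguments.
Unset Strict Implicit.
Unset Printing Implicit Defensive.
Local Open Scope classical_set_scope.
Local Open Scope ring_scope.

(** * Borel measurability on product spaces *)

Lemma countable_bigcup_measurable d (T : measurableType d) I (B : set I)
    (F : I -> set T) :
  countable B -> (forall i, B i -> measurable (F i)) ->
  measurable (\bigcup_(i in B) F i).
Proof.
move=> /pfcard_geP[->|]; first by rewrite bigcup_set0.
move=> /unsquash f mF.
have fB : range f = B by exact/image_eq.
rewrite -fB bigcup_image; apply: bigcup_measurable => k _.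
by apply: mF; exact: funS.
Qed.

Lemma open_borel_prod_measurable (X Y : ptopologicalType) (O : set (X * Y)) :
  @second_countable Y -> open O -> measurable (O : set (borel X * borel Y)).
Proof.
move=> [B cB [oB basisB]] oO.
(* Only [Y] needs a countable basis: a countable union over basic [V] of
   products [U V `*` V], with [U V] the largest admissible open set. *)
pose U (V : set Y) := [set x | V `<=` [set y | O (x, y)]]°.
have -> : O = \bigcup_(V in B) (U V `*` V).
  apply/seteqP; split => [[x y] Oxy|[x y] [V BV] [/interior_subset UVx Vy]].
  - have [[P Q] /= [Px Qy] PQO] : nbhs (x, y) O by exact: open_nbhs_nbhs.
    have [V [BV Vy] VQ] := basisB y Q Qy.
    exists V => //; split => //=; rewrite /U /interior.
    by apply: filterS Px => x' Px' y' /VQ Qy'; exact: (PQO (x', y')).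
  - exact: UVx.
apply: (@countable_bigcup_measurable _ (borel X * borel Y)%type) => // V BV.
apply: measurableX; apply: sub_sigma_algebra; last exact: oB.
exact: open_interior.
Qed.

Lemma continuous_borel_measurable (R : realType) (X : ptopologicalType)
    (f : X -> R) :
  continuous f -> measurable_fun setT (f : borel X -> R).
Proof.
move=> /continuousP cf; apply: (measurability _ (RGenOpens.measurableE R)).
move=> _ [_ [a [b ->] <-]]; rewrite setTI; apply: sub_sigma_algebra.
exact/cf/interval_open.
Qed.

Lemma continuous_borel_prod_measurable (R : realType) (X Y : ptopologicalType)
    (f : X * Y -> R) :
  @second_countable Y -> continuous f ->
  measurable_fun setT (f : borel X * borel Y -> R).
Proof.
move=> Y2 /continuousP cf; apply: (measurability _ (RGenOpens.measurableE R)).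
move=> _ [_ [a [b ->] <-]]; rewrite setTI; apply: open_borel_prod_measurable => //.
exact/cf/interval_open.
Qed.

(** * Continuity and measurability of evaluation, distance and orbits *)

Section SelfMaps.
Context (R : realType) (M : pointedMetricType R).

Lemma ball_selfmap_mdist (f g : selfmap M) x e :
  ball f e g -> mdist (f x) (g x) < e.
Proof.
move=> fg; rewrite -lte_fin; apply: le_lt_trans fg.
by apply: ereal_sup_ubound; exists x.
Qed.

Lemma continuous_selfmap (f : selfmap M) : continuous (f : M -> M).
Proof. exact: (@cts_fun _ _ (f : continuousType M M)). Qed.

(** Joint continuity uses d(f x, g y) <= d(f x, f y) + d(f y, g y): the first term is small by
    continuity of f at x, the second by the uniform distance, wherever y lies. *)
Lemma continuous_eval :
  continuous (fun p : selfmap M * M => (p.1 : selfmap M) p.2).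
Proof.
move=> [f x]; apply/cvg_ballP => e e0 /=.
have e2 : 0 < e / 2 by rewrite divr_gt0.
have /cvg_ballP/(_ _ e2) fx := @continuous_selfmap f x.
have nf : \forall g \near f, ball f (e / 2) g by exact: nbhsx_ballx.
exists (ball f (e / 2), [set y | ball (f x) (e / 2) (f y)]); first by split.
move=> [g y] [/= fg fxy]; rewrite [e]splitr; apply: (ball_triangle fxy).
by rewrite ballEmdist /=; exact: ball_selfmap_mdist.
Qed.

Lemma continuous_mdist : continuous (fun p : M * M => mdist p.1 p.2).
Proof.
move=> [x y]; apply/(@cvgrPdist_lt _ R^o) => e e0 /=.
have e2 : 0 < e / 2 by rewrite divr_gt0.
exists (ball x (e / 2), ball y (e / 2)).
  by split; exact: nbhsx_ballx.
move=> [x' y'] [/=]; rewrite !ballEmdist /= => xx' yy'.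
have h1 := metric_triangle x x' y; have h2 := metric_triangle x' y' y.
have h3 := metric_triangle x' x y'; have h4 := metric_triangle x y y'.
rewrite (metric_sym y' y) in h2; rewrite (metric_sym x' x) in h3.
rewrite ltr_norml; apply/andP; split; lra.
Qed.

Lemma lipschitz_continuous (h : M -> R) : is_lipschitz h -> continuous h.
Proof.
move=> [K hK] x; apply/(@cvgrPdist_lt _ R^o) => e e0 /=.
(* The constant [K] may be zero or negative, so [|K| + 1] serves as a positive denominator. *)
have K0 : 0 < `|K| + 1 by rewrite ltr_wpDl.
apply: filterS (nbhsx_ballx x (e / (`|K| + 1)) _); last by rewrite divr_gt0.
move=> y; rewrite ballEmdist /= ltr_pdivlMr// mulrC; apply: le_lt_trans.
apply: le_trans (hK x y) _; rewrite ler_wpM2r ?mdist_ge0//.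
by rewrite (le_trans (ler_norm K))// lerDl.
Qed.

Hypothesis cptM : compact [set: M].

Lemma compact_metric_second_countable : @second_countable M.
Proof. exact: (@compact_second_countable R M). Qed.

(** Preimages of open sets are open by joint continuity. They lie in the product sigma-algebra
    because the second factor [M] has a countable basis. *)
Lemma measurable_eval : measurable_fun setT
  (fun p : borel (selfmap M) * borel M => (p.1 : selfmap M) p.2 : borel M).
Proof.
apply: measurability; first by [].
move=> _ [U oU <-]; rewrite setTI.
apply: (open_borel_prod_measurable compact_metric_second_countable).
by have /continuousP := continuous_eval; apply.
Qed.

Lemma measurable_mdist : measurable_fun setT
  (fun p : borel M * borel M => mdist (p.1 : M) (p.2 : M)).
Proof.
apply: (continuous_borel_prod_measurable compact_metric_second_countable).
exact: continuous_mdist.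
Qed.

Lemma measurable_coord n :
  measurable_fun setT (fun w : mapseq M => w n : borel (selfmap M)).
Proof.
move=> _ A mA; rewrite setTI; apply: sub_sigma_algebra.
by exists n, A.
Qed.

Lemma measurable_orbit n : measurable_fun setT
  (fun p : borel M * mapseq M => Defs.orbit p.2 n p.1 : borel M).
Proof.
elim: n => [|n IH] /=; first exact: measurable_fst.
have := measurableT_comp measurable_eval (measurable_fun_pair
  (measurableT_comp (measurable_coord n) (@measurable_snd _ _ (borel M) (mapseq M))) IH).
exact.
Qed.
End SelfMaps.

(** * Integrals of bounded functions against probability measures *)

Section BoundedIntegral.
Context d (T : measurableType d) (R : realType) (m : probability T R).

Lemma bounded_integrable (f : T -> R) (C : R) : measurable_fun setT f ->
  (forall x, `|f x| <= C) -> m.-integrable setT (EFin \o f).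
Proof.
move=> mf fC; apply: measurable_bounded_integrable => //.
  exact: le_lt_trans (probability_le1 _ measurableT) (ltry _).
exists C; split; first by rewrite num_real.
by move=> r Cr x _; exact: le_trans (fC x) (ltW Cr).
Qed.

Lemma Rintegral_probability_cst (r : R) : \int[m]_x r = r.
Proof. by rewrite Rintegral_cst// [X in fine X](_ : _ = 1%E) ?mulr1//; exact: probability_setT. Qed.

Lemma Rintegral_bound (f : T -> R) (C : R) : measurable_fun setT f ->
  (forall x, `|f x| <= C) -> `|\int[m]_x f x| <= C.
Proof.
move=> mf fC; have iF := bounded_integrable mf fC.
apply: le_trans (le_normr_Rintegral _ iF) _ => //.
rewrite -[leRHS]Rintegral_probability_cst; apply: le_Rintegral => //.
- apply: (@bounded_integrable _ C); first exact: measurableT_comp.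
  by move=> x; rewrite normr_id.
- by apply: (@bounded_integrable _ `|C|) => //; exact: measurable_cst.
Qed.
End BoundedIntegral.

Lemma measurable_Rintegral d1 d2 (T1 : measurableType d1)
    (T2 : measurableType d2) (R : realType) (m : probability T2 R)
    (f : T1 * T2 -> R) (C : R) :
  measurable_fun setT f -> (forall x, `|f x| <= C) ->
  measurable_fun setT (fun x => \int[m]_y f (x, y)).
Proof.
move=> mf fC; apply: measurableT_comp; first exact: fine_measurable.
(* Fubini's theorem asks for a measure on the first factor as well; the Dirac mass at the base point
   is an arbitrary choice. *)
apply: (@measurable_fubini_F _ _ T1 T2 R (@dirac _ T1 point R) m (EFin \o f)).
exact: (@bounded_integrable _ _ _ (@dirac _ T1 point R \x m)%E f C).
Qed.

Lemma bounded_Fubini d1 d2 (T1 : measurableType d1) (T2 : measurableType d2)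
    (R : realType) (m1 : probability T1 R) (m2 : probability T2 R)
    (f : T1 * T2 -> R) (C : R) :
  measurable_fun setT f -> (forall x, `|f x| <= C) ->
  \int[m1]_x \int[m2]_y f (x, y) = \int[m2]_y \int[m1]_x f (x, y).
Proof.
move=> mf fC; have ig := @bounded_integrable _ _ _ (m1 \x m2)%E f C mf fC.
congr fine; transitivity (\int[m1]_x \int[m2]_y (f (x, y))%:E)%E.
  apply: eq_integral => x _; rewrite fineK//; apply: integrable_fin_num => //.
  by apply: (@bounded_integrable _ _ _ _ _ C) => //; exact: measurableT_comp.
rewrite (Fubini ig); apply: eq_integral => y _.
rewrite fineK//; apply: integrable_fin_num => //.
by apply: (@bounded_integrable _ _ _ _ _ C) => //; exact: measurableT_comp.
Qed.

Section ProductImage.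
Context d1 d2 d3 (T1 : measurableType d1) (T2 : measurableType d2)
  (T3 : measurableType d3) (R : realType).
Context (m1 : probability T1 R) (m2 : probability T2 R) (m : probability T3 R).

Variable phi : T1 * T2 -> T3.
Hypothesis mphi : measurable_fun setT phi.
Hypothesis phi_preserving : forall A, measurable A ->
  (m1 \x m2)%E (phi @^-1` A) = m A.

(** Change of variables along [phi], then Fubini. It serves with [mapseq_cons], to split off the
    first map, and with evaluation, to exploit stationarity. *)
Lemma Rintegral_product_image (g : T3 -> R) (C : R) :
  measurable_fun setT g -> (forall x, `|g x| <= C) ->
  \int[m]_z g z = \int[m1]_x \int[m2]_y g (phi (x, y)).
Proof.
move=> mg gC.
have ig : (m1 \x m2)%E.-integrable setT (EFin \o (g \o phi)).
  apply: (@bounded_integrable _ _ _ (m1 \x m2)%E _ C).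
    exact: measurableT_comp.
  by move=> x; exact: gC.
have mE : \int[m]_z g z = \int[(m1 \x m2)%E]_p g (phi p).
  congr fine.
  have mEg : measurable_fun setT (EFin \o g) by exact/measurable_EFinP.
  rewrite -[RHS](integral_pushforward mphi mEg ig measurableT).
  by apply: eq_measure_integral => A mA _ /=; rewrite -phi_preserving.
rewrite mE; congr fine.
rewrite -(integral12_prod_meas1 ig); apply: eq_integral => x _.
rewrite fineK//; apply: integrable_fin_num => //.
apply: (@bounded_integrable _ _ _ _ _ C) => //.
by apply: measurableT_comp => //; exact: measurableT_comp.
Qed.
End ProductImage.

(** * Independence of the first map, and stationarity *)

Section Shift.
Context (R : realType) (M : pointedMetricType R).

Definition mapseq_cons (p : borel (selfmap M) * mapseq M) : mapseq M :=
  fun n => if n is k.+1 then p.2 k else p.1.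

Lemma measurable_mapseq_cons : measurable_fun setT mapseq_cons.
Proof.
apply: measurability; first by [].
move=> _ [_ [[|i] [A [mA ->]]] <-]; rewrite setTI.
  rewrite (_ : _ @^-1` _ = fst @^-1` A)//.
  by rewrite -[X in measurable X]setTI; exact: measurable_fst.
rewrite (_ : _ @^-1` _ = snd @^-1` [set w : mapseq M | A (w i)])//.
rewrite -[X in measurable X]setTI; apply: measurable_snd => //.
by rewrite -[X in measurable X]setTI; exact: measurable_coord.
Qed.

(** [orbit] recurses on the last map applied; this form exposes the first one, on which all later
    inductions condition. *)
Lemma orbit_cons p n x :
  Defs.orbit (mapseq_cons p) n.+1 x = Defs.orbit p.2 n ((p.1 : selfmap M) x).
Proof. by elim: n => //= n <-. Qed.

Lemma birkhoff_sum_cons (h : M -> R) n x p :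
  birkhoff_sum h n.+1 x (mapseq_cons p) =
  h x + birkhoff_sum h n ((p.1 : selfmap M) x) p.2.
Proof.
rewrite /birkhoff_sum big_ord_recl; congr +%R.
by apply: eq_bigr => i _; rewrite -orbit_cons.
Qed.

Let box n (A : nat -> set (borel (selfmap M))) : set (mapseq M) :=
  [set w | forall i, (i < n)%N -> A i (w i)].

(** Cylinders constrain a single coordinate and need not be closed under intersection. Boxes are,
    and [is_power_measure] prescribes their measure, so they suit the uniqueness theorem for
    measures. *)
Let boxes : set (set (mapseq M)) :=
  [set B | exists n A, (forall i, measurable (A i)) /\ B = box n A].

Let measurable_box n A : (forall i, measurable (A i)) -> measurable (box n A).
Proof.
move=> mA; rewrite (_ : box n A =
    \bigcap_(i in `I_n) ((fun w : mapseq M => w i) @^-1` A i))//.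
apply: fin_bigcap_measurable => // i _.
by rewrite -[X in measurable X]setTI; exact: measurable_coord.
Qed.

Let measurable_boxesE : @measurable _ (mapseq M) = <<s boxes >>.
Proof.
apply/seteqP; split; apply: smallest_sub; try exact: smallest_sigma_algebra.
- move=> _ [i [A [mA ->]]]; apply: sub_sigma_algebra.
  exists i.+1, (fun j => if j == i then A else setT); split.
    by move=> j; case: ifP.
  apply/seteqP; split => [w Aw j _|w /(_ i (ltnSn i))]; last by rewrite eqxx.
  by case: eqVneq => // ->.
- by move=> _ [n [A [mA ->]]]; exact: measurable_box.
Qed.

Let setI_closed_boxes : setI_closed boxes.
Proof.
move=> _ _ [n [A [mA ->]]] [k [B [mB ->]]].
exists (maxn n k), (fun i => (if (i < n)%N then A i else setT) `&`
                             (if (i < k)%N then B i else setT)); split.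
  by move=> i; apply: measurableI; case: ifP.
apply/seteqP; split => [w [Aw Bw] i _|w ABw].
  by split; case: ifP => // ik; [exact: Aw|exact: Bw].
split => i ik; have := ABw i; rewrite leq_max ik ?orbT => /(_ isT)[].
- by [].
- by [].
Qed.

Context (nu : probability (borel (selfmap M)) R) (P : probability (mapseq M) R).
Hypothesis nuP : is_power_measure nu P.

(** A box of length n+1 pulls back to the product of its first side and a box of length n, so both
    measures agree on boxes, a generating pi-system. *)
Lemma mapseq_cons_preserving A : measurable A ->
  (nu \x P)%E (mapseq_cons @^-1` A) = P A.
Proof.
have mc := measurable_mapseq_cons.
pose c : {mfun _ >-> _} := HB.pack mapseq_cons (isMeasurableFun.Build _ _ _ _ _ mc).
pose Q := distribution (nu \x P)%E c.
have QE B : Q B = (nu \x P)%E (mapseq_cons @^-1` B) by [].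
rewrite -QE; apply: (measure_unique boxes (fun=> setT)) => //.
(* The whole space is the box of length 0, so the constant sequence covers it. *)
- by move=> _; exists 0%N, (fun=> setT); split => //; apply/seteqP; split.
- by rewrite bigcup_const//; exists 0%N.
- move=> _ [[|n] [B [mB ->]]].
    rewrite (_ : box 0 B = setT); last by apply/seteqP; split.
    by rewrite [LHS]probability_setT [RHS]probability_setT.
  rewrite [LHS]QE (_ : _ @^-1` _ = B 0%N `*` box n (fun i => B i.+1)).
    rewrite [LHS]product_measure1E//; last by apply: measurable_box => i.
    rewrite [RHS](nuP n.+1 mB) big_ord_recl; congr (_ * _)%E.
    exact: (nuP n (fun i => mB i.+1)).
  apply/seteqP; split => [[f w] /= Bfw|[f w] /= [Bf Bw] [|i] //].
    by split => [|i ik] /=; [exact: (Bfw 0%N)|exact: (Bfw i.+1)].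
  exact: Bw.
- by move=> _; rewrite [X in (X < _)%E]probability_setT ltry.
Qed.

Section Stationary.
Context (eta : probability (borel M) R).
Hypotheses (cptM : compact [set: M]) (eta_stat : stationary nu eta).

Lemma closed_topsupport : closed (topsupport nu).
Proof.
rewrite -openC openE => f /= /existsNP[U /not_implyP[oU /not_implyP[Uf nuU]]].
rewrite /interior nbhsE; exists U => // g Ug supg; apply: nuU; exact: supg.
Qed.

Lemma measurable_topsupport : measurable (topsupport nu : set (borel (selfmap M))).
Proof.
rewrite -[topsupport nu]setCK; apply: measurableC; apply: sub_sigma_algebra.
exact/closed_openC/closed_topsupport.
Qed.

(* Stationarity applied to the whole space gives full measure without any
   appeal to the separability of [C(M)]. *)
Lemma stationary_topsupport1 : nu (topsupport nu) = 1%E.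
Proof.
transitivity (\int[nu]_(f in topsupport nu) 1)%E.
  by rewrite integral_cst ?mul1e//; exact: measurable_topsupport.
transitivity (eta setT); last exact: probability_setT.
rewrite (eta_stat measurableT); apply: eq_integral => f _.
by symmetry; exact: probability_setT.
Qed.

(** The section at f of the preimage of [A] under evaluation is the preimage of [A] under f, so the
    product measure is the integral in [stationary]. This is the form that [Rintegral_product_image]
    takes. *)
Lemma eval_preserving (A : set (borel M)) : measurable A ->
  (nu \x eta)%E ((fun p : borel (selfmap M) * borel M =>
    (p.1 : selfmap M) p.2 : borel M) @^-1` A) = eta A.
Proof.
move=> mA; rewrite (eta_stat mA).
have mE := measurable_eval cptM.
set ev := fun p => _ in mE *.
have mvA : measurable (ev @^-1` A).
  by rewrite -[X in measurable X]setTI; exact: mE.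
rewrite /product_measure1.
have xsecE : eta \o xsection (ev @^-1` A) =
    (fun f : borel (selfmap M) => eta ((f : selfmap M) @^-1` A)).
  by apply/funext => f /=; rewrite /xsection; congr (eta _); apply/seteqP;
    split => x; rewrite /= inE.
(* The product measure integrates over all of C(M), [stationary] only over the support; the
   complement is null. *)
rewrite xsecE (@ge0_negligible_integral _ _ _ nu setT (~` topsupport nu)).
- by rewrite setTD setCK.
- by apply: measurableC; exact: measurable_topsupport.
- by [].
- by rewrite -xsecE; exact: measurable_fun_xsection.
- by move=> f _; exact: measure_ge0.
- rewrite [LHS]probability_setC; last exact: measurable_topsupport.
  by rewrite [X in (1 - X)%E]stationary_topsupport1 subee.
Qed.
End Stationary.
End Shift.

(** * Means and exponential moments of Birkhoff sums *)

Lemma expR_le_add_expR_sqr (R : realType) (x : R) :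
  expR x <= x + expR (2 * x ^+ 2).
Proof.
have [x_le|x_gt] := lerP x (1 / 2); last first.
  (* For x > 1/2 the exponential alone suffices, as x <= 2 x^2. *)
  apply: (@le_trans _ _ (expR (2 * x ^+ 2))); last by rewrite lerDr; lra.
  by rewrite ler_expR; nra.
(* For x <= 1/2 it suffices that exp x <= 1 + x + 2 x^2. This follows from (1 - x) exp x <= 1 and (1
   - x)(1 + x + 2 x^2) = 1 + x^2 (1 - 2 x) >= 1. *)
have := expR_ge1Dx (2 * x ^+ 2); suff : expR x <= 1 + x + 2 * x ^+ 2 by lra.
have [] := (expR_ge1Dx (- x), expR_gt0 x); rewrite expRN => h e0.
have {}h : (1 - x) * expR x <= 1 by rewrite -ler_pdivlMr// mul1r.
rewrite -(@ler_pM2l _ (1 - x)); last by lra.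
by apply: le_trans h _; nra.
Qed.

Section Birkhoff.
Context (R : realType) (M : pointedMetricType R).
Hypothesis cptM : compact [set: M].
Context (nu : probability (borel (selfmap M)) R) (P : probability (mapseq M) R).
Hypothesis nuP : is_power_measure nu P.
Context (h : M -> R) (H : R).
Hypotheses (ch : continuous h) (hH : forall x, `|h x| <= H).

Lemma measurable_birkhoff_sum n : measurable_fun setT
  (fun p : borel M * mapseq M => birkhoff_sum h n p.1 p.2).
Proof.
apply: measurable_sum => k.
apply: measurableT_comp (measurable_orbit cptM k).
exact: continuous_borel_measurable.
Qed.

Lemma measurable_birkhoff_sum_at n x :
  measurable_fun setT (birkhoff_sum h n x : mapseq M -> R).
Proof.
exact: (measurableT_comp (measurable_birkhoff_sum n)
  (@pair1_measurable _ _ (borel M) (mapseq M) x)).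
Qed.

Lemma birkhoff_sum_bound n x w : `|birkhoff_sum h n x w| <= n%:R * H.
Proof.
rewrite /birkhoff_sum (le_trans (ler_norm_sum _ _ _))//.
rewrite (le_trans (ler_sum _ (fun i _ => hH _)))// sumr_const card_ord.
by rewrite mulr_natl.
Qed.

Definition birkhoff_mean n (x : borel M) : R := \int[P]_w birkhoff_sum h n x w.
Local Notation V := birkhoff_mean.

Lemma measurable_birkhoff_mean n : measurable_fun setT (V n).
Proof.
apply: (@measurable_Rintegral _ _ (borel M) (mapseq M) R P
  (fun p => birkhoff_sum h n p.1 p.2) (n%:R * H)).
  exact: measurable_birkhoff_sum.
by move=> [x w]; exact: birkhoff_sum_bound.
Qed.

Lemma birkhoff_mean_bound n x : `|V n x| <= n%:R * H.
Proof.
apply: Rintegral_bound; first exact: measurable_birkhoff_sum_at.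
exact: birkhoff_sum_bound.
Qed.

Lemma measurable_eval_at (x : M) :
  measurable_fun setT (fun f : borel (selfmap M) => (f : selfmap M) x : borel M).
Proof.
exact: (measurableT_comp (measurable_eval cptM)
  (@pair2_measurable _ _ (borel (selfmap M)) (borel M) x)).
Qed.

Lemma integrable_birkhoff_mean_eval n x : nu.-integrable setT
  (EFin \o (fun f : borel (selfmap M) => V n ((f : selfmap M) x))).
Proof.
apply: (@bounded_integrable _ _ _ _ _ (n%:R * H)).
  exact: (measurableT_comp (measurable_birkhoff_mean n) (measurable_eval_at x)).
by move=> f; exact: birkhoff_mean_bound.
Qed.

(** Given the first map f, the remaining terms form an independent Birkhoff sum of length n started
    at f x. *)
Lemma birkhoff_meanS n x :
  V n.+1 x = h x + \int[nu]_f V n ((f : selfmap M) x).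
Proof.
rewrite {1}/V (Rintegral_product_image (@measurable_mapseq_cons R M)
  (mapseq_cons_preserving nuP) (measurable_birkhoff_sum_at n.+1 x)
  (birkhoff_sum_bound n.+1 x)).
have iV := integrable_birkhoff_mean_eval n x.
rewrite -[X in _ = X + _](Rintegral_probability_cst nu) -RintegralD//; last first.
  by apply: (@bounded_integrable _ _ _ _ _ `|h x|) => //; exact: measurable_cst.
apply: eq_Rintegral => f _.
under eq_Rintegral do rewrite birkhoff_sum_cons.
rewrite RintegralD// ?Rintegral_probability_cst//.
- by apply: (@bounded_integrable _ _ _ _ _ `|h x|) => //; exact: measurable_cst.
- apply: (@bounded_integrable _ _ _ _ _ (n%:R * H)).
    exact: measurable_birkhoff_sum_at.
  exact: birkhoff_sum_bound.
Qed.


Section Concentration.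
Variable c : R.
Hypothesis V_osc : forall n x y, `|V n x - V n y| <= c.

Let Z s n x (w : mapseq M) : R := expR (s * (birkhoff_sum h n x w - V n x)).

Let measurable_Z s n x : measurable_fun setT (Z s n x).
Proof.
apply: measurableT_comp => //; apply: measurable_funM => //.
by apply: measurable_funB => //; exact: measurable_birkhoff_sum_at.
Qed.

Let Z_bound s n x w : `|Z s n x w| <= expR (`|s| * (n%:R * H + n%:R * H)).
Proof.
rewrite ger0_norm ?expR_ge0// ler_expR (le_trans (ler_norm _))// normrM.
rewrite ler_wpM2l// (le_trans (ler_normB _ _))//.
by apply: lerD; [exact: birkhoff_sum_bound|exact: birkhoff_mean_bound].
Qed.

(** An Azuma-Hoeffding argument without filtrations: the induction covers all starting points at
    once, because the sum restarts at f x after the first map. *)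
Lemma birkhoff_mgf_le s n x :
  \int[P]_w expR (s * (birkhoff_sum h n x w - V n x)) <=
  expR (2 * n%:R * (s * c) ^+ 2).
Proof.
elim: n x => [|n IH] x.
  rewrite mulr0 mul0r expR0 (@eq_Rintegral _ _ _ _ setT (fun=> 1)).
    by rewrite Rintegral_probability_cst.
  move=> w _; rewrite /V (@eq_Rintegral _ _ _ _ setT (fun=> 0)).
    by rewrite Rintegral_probability_cst /birkhoff_sum big_ord0 subrr mulr0 expR0.
  by move=> w' _; rewrite /birkhoff_sum big_ord0.
rewrite (Rintegral_product_image (@measurable_mapseq_cons R M)
  (mapseq_cons_preserving nuP) (measurable_Z s n.+1 x) (Z_bound s n.+1 x)).
(* [D] is the first increment of the martingale of conditional means of the sum. *)
pose a := \int[nu]_f V n ((f : selfmap M) x).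
pose D (f : borel (selfmap M)) := V n ((f : selfmap M) x) - a.
have iV := integrable_birkhoff_mean_eval n x.
(* [D f] is the average over g of V n (f x) - V n (g x), and each difference is at most [c] in
   absolute value. *)
have D_bound f : `|D f| <= c.
  rewrite /D /a -[X in X - _](Rintegral_probability_cst nu) -RintegralB//; last first.
    by apply: (@bounded_integrable _ _ _ _ _ `|V n ((f : selfmap M) x)|) => //; exact: measurable_cst.
  apply: Rintegral_bound; last by move=> g; exact: V_osc.
  apply: measurable_funB => //.
  exact: (measurableT_comp (measurable_birkhoff_mean n) (measurable_eval_at x)).
have mD : measurable_fun setT D.
  apply: measurable_funB => //.
  exact: (measurableT_comp (measurable_birkhoff_mean n) (measurable_eval_at x)).
have intD : \int[nu]_f D f = 0.
  rewrite RintegralB// ?Rintegral_probability_cst ?subrr//.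
  by apply: (@bounded_integrable _ _ _ _ _ `|a|) => //; exact: measurable_cst.
set E := expR (2 * n%:R * (s * c) ^+ 2).
set K := expR (2 * (s * c) ^+ 2).
have iD : nu.-integrable setT (EFin \o D) by exact: bounded_integrable D_bound.
have iKD : nu.-integrable setT (EFin \o (fun f => s * D f + K)).
  apply: (@bounded_integrable _ _ _ _ _ (`|s| * c + `|K|)).
    by apply: measurable_funD => //; apply: measurable_funM.
  by move=> f; rewrite (le_trans (ler_normD _ _))// lerD2r normrM ler_wpM2l.
(* For fixed f, the factor exp (s D f) is at most s D f + [K], and the induction hypothesis at f x
   bounds the remaining integral by [E]. *)
apply: (@le_trans _ _ (\int[nu]_f ((s * D f + K) * E))).
  apply: le_Rintegral => //.
  - apply: (@bounded_integrable _ _ _ _ _ (expR (`|s| * (n.+1%:R * H + n.+1%:R * H)))).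
      apply: (@measurable_Rintegral _ _ _ _ R P (fun p => Z s n.+1 x (mapseq_cons p))
         (expR (`|s| * (n.+1%:R * H + n.+1%:R * H)))).
        exact: measurableT_comp (measurable_Z s n.+1 x) (@measurable_mapseq_cons R M).
      by move=> p; exact: Z_bound.
    move=> f; apply: Rintegral_bound; last by move=> w; exact: Z_bound.
    apply: measurableT_comp (measurable_Z s n.+1 x) _.
    exact: measurableT_comp (@measurable_mapseq_cons R M) (@pair1_measurable _ _ _ _ f).
  - apply: (@bounded_integrable _ _ _ _ _ ((`|s| * c + `|K|) * `|E|)).
      by apply: measurable_funM => //; apply: measurable_funD => //; apply: measurable_funM.
    move=> f; rewrite normrM ler_wpM2r//.
    by rewrite (le_trans (ler_normD _ _))// lerD2r normrM ler_wpM2l.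
  move=> f _.
  rewrite (@eq_Rintegral _ _ _ _ setT (fun w => expR (s * D f) * Z s n ((f : selfmap M) x) w)); last first.
    move=> w _; rewrite /Z -expRD; congr expR.
    by rewrite birkhoff_sum_cons birkhoff_meanS /D /a /=; ring.
  rewrite RintegralZl//; last first.
    by apply: bounded_integrable; [exact: measurable_Z|exact: Z_bound].
  apply: ler_pM => //.
  - by apply: Rintegral_ge0 => w _; exact: expR_ge0.
  - apply: le_trans (expR_le_add_expR_sqr _) _; rewrite lerD2l ler_expR ler_wpM2l//.
    rewrite !exprMn ler_wpM2l ?sqr_ge0// -(real_normK (num_real (D f))).
    by rewrite lerXn2r ?nnegrE // (le_trans _ (D_bound f)).
  - exact: IH.
(* The linear term integrates to zero as [D] is centred, which leaves the product of [K] and [E],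
   the bound for n+1. *)
rewrite RintegralZr// RintegralD//; last 2 first.
- by apply: (@bounded_integrable _ _ _ _ _ (`|s| * c)) => [|f];
    [exact: measurable_funM|rewrite normrM ler_wpM2l].
- by apply: (@bounded_integrable _ _ _ _ _ `|K|) => //; exact: measurable_cst.
rewrite RintegralZl// intD mulr0 add0r Rintegral_probability_cst.
by rewrite /K /E -expRD ler_expR -natr1; lra.
Qed.

End Concentration.
End Birkhoff.

(** * Tail bounds and comparison with the stationary mean *)

Lemma subgaussian_tail d (T : measurableType d) (R : realType)
    (P : probability T R) (X : T -> R) (C v u : R) :
  measurable_fun setT X -> (forall w, `|X w| <= C) -> 0 < v -> 0 < u ->
  (forall s, \int[P]_w expR (s * X w) <= expR (s ^+ 2 * v)) ->
  (P [set w | u <= `|X w|]%R <= 2%:E * (expR (- (u ^+ 2 / (4 * v))))%:E)%E.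
Proof.
move=> mX XC v0 u0 mgf.
have one_sided (Y : T -> R) : measurable_fun setT Y -> (forall w, `|Y w| <= C) ->
    (forall s, \int[P]_w expR (s * Y w) <= expR (s ^+ 2 * v)) ->
    (P [set w | u <= Y w]%R <= (expR (- (u ^+ 2 / (4 * v))))%:E)%E.
  (* This [s] minimises s^2 v - s u, with minimum - u^2 / (4 v). *)
  move=> mY YC mgfY; pose s := u / (2 * v).
  have s0 : 0 < s by rewrite divr_gt0// mulr_gt0.
  pose Y' : {RV P >-> R} := HB.pack Y (isMeasurableFun.Build _ _ _ _ _ mY).
  have := @chernoff _ _ _ P Y' s u s0; move/le_trans; apply.
  have iE : P.-integrable setT (EFin \o (fun w => expR (s * Y w))).
    apply: (@bounded_integrable _ _ _ _ _ (expR (s * C))).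
      by apply: measurableT_comp => //; exact: measurable_funM.
    move=> w; rewrite ger0_norm ?expR_ge0// ler_expR ler_wpM2l ?(ltW s0)//.
    exact: le_trans (ler_norm _) (YC w).
  rewrite /mmt_gen_fun unlock.
  have -> : (\int[P]_w ((expR \o s \o* Y') w)%:E)%E =
      (\int[P]_w expR (s * Y w))%:E.
    rewrite /Rintegral fineK; last exact: integrable_fin_num.
    by apply: eq_integral => w _ /=; rewrite mulrC.
  rewrite -EFinM lee_fin (le_trans (ler_wpM2r (expR_ge0 _) (mgfY s)))//.
  rewrite -expRD ler_expR le_eqVlt; apply/orP; left; apply/eqP; rewrite /s.
  by field; exact: lt0r_neq0.
have mset (Y : T -> R) : measurable_fun setT Y -> measurable [set w | u <= Y w].
  move=> mY; rewrite -[X in measurable X]setTI.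
  have := mY measurableT _ (measurable_itv `[u, +oo[%R).
  by congr (measurable (_ `&` _)); apply/seteqP; split => w /=; rewrite in_itv/= andbT.
have mN : measurable_fun setT (fun w => - X w) by exact: measurableT_comp.
(* The factor 2 is the union bound over [X] and [- X]; the latter inherits the moment hypothesis,
   which covers negative s. *)
have -> : [set w | u <= `|X w|] = [set w | u <= X w] `|` [set w | u <= - X w].
  by apply/seteqP; split => w /=; rewrite ler_normr => /orP.
apply: le_trans (measureU2 _ _ _) _; [exact: mset|exact: mset|].
rewrite mule_natl mule2n leeD//; first exact: one_sided.
apply: one_sided => //; first by move=> w; rewrite normrN.
by move=> s; under eq_Rintegral do rewrite mulrN -mulNr; rewrite -sqrrN; exact: mgf.
Qed.

Section Rate.
Context (R : realType) (M : pointedMetricType R).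
Hypothesis cptM : compact [set: M].
Context (nu : probability (borel (selfmap M)) R) (P : probability (mapseq M) R).
Hypothesis nuP : is_power_measure nu P.
Context (h : M -> R) (H : R).
Hypotheses (ch : continuous h) (hH : forall x, `|h x| <= H).
Local Notation V := (birkhoff_mean P h).

Lemma birkhoff_tail c n x u :
  (forall n x y, `|V n x - V n y| <= c) -> 0 < c -> (0 < n)%N -> 0 < u ->
  (P [set w | u <= `|birkhoff_sum h n x w - V n x|]%R <=
   2%:E * (expR (- (u ^+ 2 / (8 * n%:R * c ^+ 2))))%:E)%E.
Proof.
move=> V_osc c0 n0 u0.
(* The variance proxy is v = 2 n c^2, read off from [birkhoff_mgf_le]. *)
have -> : 8 * n%:R * c ^+ 2 = 4 * (2 * n%:R * c ^+ 2) by ring.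
apply: (@subgaussian_tail _ _ _ _ _ (n%:R * H + n%:R * H)) => //.
- by apply: measurable_funB => //; exact: measurable_birkhoff_sum_at.
- move=> w; rewrite (le_trans (ler_normB _ _))//.
  by apply: lerD; [exact: birkhoff_sum_bound|exact: birkhoff_mean_bound].
- by rewrite !mulr_gt0 ?exprn_gt0// ltr0n.
- move=> s; have -> : s ^+ 2 * (2 * n%:R * c ^+ 2) = 2 * n%:R * (s * c) ^+ 2 by ring.
  exact: (birkhoff_mgf_le cptM nuP ch hH V_osc).
Qed.

Context (eta : probability (borel M) R).
Hypothesis eta_stat : stationary nu eta.

Let ieta n : eta.-integrable setT (EFin \o V n).
Proof.
apply: (@bounded_integrable _ _ _ _ _ (n%:R * H)).
  exact: measurable_birkhoff_mean.
by move=> x; exact: birkhoff_mean_bound.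
Qed.

(** Integrating [birkhoff_meanS] against [eta], each step adds [mean eta h], and averaging V n over
    one random map preserves its [eta]-mean by stationarity. *)
Lemma stationary_birkhoff_mean n : \int[eta]_x V n x = n%:R * mean eta h.
Proof.
have ih : eta.-integrable setT (EFin \o (h : borel M -> R)).
  apply: (@bounded_integrable _ _ _ _ _ H) => //.
  exact: continuous_borel_measurable.
elim: n => [|n IH].
  rewrite mul0r (@eq_Rintegral _ _ _ _ setT (fun=> 0)).
    by rewrite Rintegral_probability_cst.
  move=> x _; rewrite /birkhoff_mean (@eq_Rintegral _ _ _ _ setT (fun=> 0)).
    by rewrite Rintegral_probability_cst.
  by move=> w _; rewrite /birkhoff_sum big_ord0.
under eq_Rintegral do rewrite (birkhoff_meanS cptM nuP ch hH).
have mV : measurable_fun setT (V n) by exact: measurable_birkhoff_mean.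
have bV y : `|V n y| <= n%:R * H by exact: birkhoff_mean_bound.
have mVx : measurable_fun setT
    (fun p : borel M * borel (selfmap M) => V n ((p.2 : selfmap M) p.1)).
  apply: (measurableT_comp mV).
  exact: (measurableT_comp (measurable_eval cptM)
    (@measurable_swap _ _ (borel M) (borel (selfmap M)))).
rewrite RintegralD//; last first.
  apply: (@bounded_integrable _ _ _ _ _ (n%:R * H)).
    exact: (@measurable_Rintegral _ _ (borel M) (borel (selfmap M)) R nu _
      (n%:R * H) mVx (fun p => bV _)).
  move=> x; apply: Rintegral_bound => //.
  exact: (measurableT_comp mV (measurable_eval_at cptM x)).
rewrite -natr1 mulrDl mul1r [RHS]addrC -IH; congr +%R.
(* [Rintegral_product_image] has [nu] outside and [eta] inside, hence the exchange. *)
rewrite (bounded_Fubini _ _ mVx (fun p => bV _)).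
by rewrite [RHS](Rintegral_product_image (measurable_eval cptM)
  (eval_preserving cptM eta_stat) mV bV).
Qed.

(** The number n eta(h) is the [eta]-average of V n, all of whose values lie within [c] of V n x. *)
Lemma birkhoff_bias c n x : (forall x y, `|V n x - V n y| <= c) ->
  `|V n x - n%:R * mean eta h| <= c.
Proof.
move=> V_osc; rewrite -stationary_birkhoff_mean.
rewrite -[X in X - _](Rintegral_probability_cst eta) -RintegralB//; last first.
  by apply: (@bounded_integrable _ _ _ _ _ `|V n x|) => //; exact: measurable_cst.
apply: Rintegral_bound => //.
by apply: measurable_funB => //; exact: measurable_birkhoff_mean.
Qed.
End Rate.

(** * Lipschitz functions and the contraction sum *)

Section Contraction.
Context (R : realType) (M : pointedMetricType R).
Hypothesis cptM : compact [set: M].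
Context (P : probability (mapseq M) R) (h : M -> R).
Hypothesis lip_h : is_lipschitz h.

Lemma lipschitz_const_ub x y : `|h x - h y| <= lipschitz_const h * mdist x y.
Proof.
have [->|xy] := eqVneq x y; first by rewrite subrr normr0 mdistxx mulr0.
rewrite -ler_pdivrMr ?mdist_gt0//; apply: ub_le_sup; last by exists (x, y).
have [K hK] := lip_h; exists K => _ [[a b] /= ab <-].
by rewrite ler_pdivrMr ?mdist_gt0.
Qed.

Lemma lipschitz_const_ge0 : 0 <= lipschitz_const h.
Proof.
have [[x [y xy]]|all_eq] := pselect (exists x y : M, x != y).
  have := le_trans (normr_ge0 _) (lipschitz_const_ub x y).
  by rewrite pmulr_lge0// mdist_gt0.
rewrite /lipschitz_const (_ : [set p : M * M | _] = set0) ?image_set0 ?sup0//.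
by apply/seteqP; split => // -[x y] /= xy; apply: all_eq; exists x, y.
Qed.

Local Open Scope ereal_scope.

Lemma contraction_sum_ub n (x y : M) :
  \sum_(k < n) 'E_P[fun w => mdist (Defs.orbit w k x) (Defs.orbit w k y)] <=
  contraction_sum P.
Proof.
apply: (@le_trans _ _ (\sum_(0 <= k <oo)
    'E_P[fun w => mdist (Defs.orbit w k x) (Defs.orbit w k y)])).
  rewrite -(big_mkord xpredT (fun k => 'E_P[fun w => mdist (Defs.orbit w k x) (Defs.orbit w k y)])).
  apply: nneseries_lim_ge => k _ _.
  by apply: expectation_ge0 => w; exact: mdist_ge0.
by apply: ereal_sup_ubound; exists (x, y).
Qed.

Lemma contraction_sum_ge0 : 0 <= contraction_sum P.
Proof. by have := contraction_sum_ub 0 point point; rewrite big_ord0. Qed.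

(** The term of index 0 in the series is d(x, y) itself, so the contraction sum dominates the
    diameter of [M]. *)
Lemma mdist_contraction_sum (x y : M) : (mdist x y)%:E <= contraction_sum P.
Proof.
by have := contraction_sum_ub 1 x y; rewrite big_ord1 (expectation_cst P (mdist x y)).
Qed.

Lemma measurable_mdist_orbit k (x y : M) : measurable_fun setT
  (fun w : mapseq M => mdist (Defs.orbit w k x) (Defs.orbit w k y)).
Proof.
have mo z : measurable_fun setT (fun w : mapseq M => Defs.orbit w k z : borel M).
  exact: (measurableT_comp (measurable_orbit cptM k)
    (@pair1_measurable _ _ (borel M) (mapseq M) z)).
exact: (measurableT_comp (measurable_mdist cptM)
  (measurable_fun_pair (mo x) (mo y))).
Qed.

Lemma lipschitz_bounded (l : R) x : contraction_sum P = l%:E ->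
  (`|h x| <= `|h point| + lipschitz_const h * l)%R.
Proof.
move=> lE; have := lipschitz_const_ub x point.
have : (lipschitz_const h * mdist x point <= lipschitz_const h * l)%R.
  rewrite ler_wpM2l ?lipschitz_const_ge0// -lee_fin -lE.
  exact: mdist_contraction_sum.
have := ler_normD (h x - h point)%R (h point); rewrite subrK.
lra.
Qed.

(** Termwise, |h (X_k^x) - h (X_k^y)| is at most the Lipschitz constant times d(X_k^x, X_k^y), and
    the partial sums of the expected distances stay below the contraction sum for every n. *)
Lemma birkhoff_mean_osc (l : R) n x y : contraction_sum P = l%:E ->
  (`|birkhoff_mean P h n x - birkhoff_mean P h n y| <= lipschitz_const h * l)%R.
Proof.
move=> lE; have ch := lipschitz_continuous lip_h.
have hH z := lipschitz_bounded z lE; set H := (_ + _)%R in hH.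
have mS z := measurable_birkhoff_sum_at cptM ch n z.
have iS z : P.-integrable setT (EFin \o (birkhoff_sum h n z : mapseq M -> R)).
  apply: (@bounded_integrable _ _ _ _ _ (n%:R * H)); first exact: mS.
  by move=> w; exact: birkhoff_sum_bound.
rewrite /birkhoff_mean -RintegralB// -lee_fin EFin_normr_Rintegral//; last first.
  by rewrite (_ : _ \o _ = (EFin \o (birkhoff_sum h n x : mapseq M -> R)) \-
    (EFin \o (birkhoff_sum h n y : mapseq M -> R)))//; exact: integrableB.
apply: le_trans.
  apply: le_abse_integral => //; apply/measurable_EFinP.
  exact: measurable_funB.
pose d k w := mdist (Defs.orbit w k x) (Defs.orbit w k y).
have md k : measurable_fun setT (fun w => (d k w)%:E).
  by apply/measurable_EFinP; exact: measurable_mdist_orbit.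
have L0 := lipschitz_const_ge0.
apply: (@le_trans _ _ (\int[P]_w \sum_(k < n)
    ((lipschitz_const h)%:E * (d k w)%:E))).
  apply: ge0_le_integral => //.
  - by do 2 apply: measurableT_comp => //; exact: measurable_funB.
  - by apply: emeasurable_sum => k; exact: measurable_funeM.
  - move=> w _; rewrite sumEFin lee_fin /birkhoff_sum -sumrB.
    rewrite (le_trans (ler_norm_sum _ _ _))// ler_sum// => k _.
    exact: lipschitz_const_ub.
rewrite ge0_integral_sum//; last 2 first.
- by move=> k; exact: measurable_funeM.
- by move=> k w _; rewrite mule_ge0 ?lee_fin// mdist_ge0.
rewrite (eq_bigr (fun k : 'I_n => (lipschitz_const h)%:E *
    'E_P[fun w => mdist (Defs.orbit w k x) (Defs.orbit w k y)])); last first.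
  move=> k _; rewrite unlock ge0_integralZl//.
  by move=> w _; rewrite lee_fin mdist_ge0.
rewrite -ge0_sume_distrr; last first.
  by move=> k _; apply: expectation_ge0 => w; exact: mdist_ge0.
by rewrite EFinM -lE; apply: lee_wpmul2l; [rewrite lee_fin|exact: contraction_sum_ub].
Qed.
End Contraction.

(** * The concentration inequality and uniform convergence of the means *)

Local Open Scope ereal_scope.

(** An empty supremum is -oo in [\bar R], so the support must be shown nonempty; it has measure one
    by stationarity. *)
Lemma rho_diam_topsupport_ge0 (R : realType) (M : pointedMetricType R)
    (nu : probability (borel (selfmap M)) R) (eta : probability (borel M) R) :
  stationary nu eta -> 0 <= rho_diam (topsupport nu).
Proof.
move=> eta_stat; have [G0|/set0P[f Gf]] := eqVneq (topsupport nu) set0.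
  have := stationary_topsupport1 eta_stat; rewrite G0 measure0 => /eqP.
  by rewrite eq_sym onee_eq0.
apply: (@le_trans _ _ (rho_sup f f)); last by apply: ereal_sup_ubound; exists f => //; exists f.
by apply: ereal_sup_ubound; exists point => //; rewrite mdistxx.
Qed.

(* Division and exponential are those of \bar R: 1/0 = +oo and
   expeR (- +oo) = 0, the intended reading when [h] is constant. *)
Theorem theorem6 (R : realType) (M : pointedMetricType R)
    (cptM : compact [set: M])
    (nu : probability (borel (selfmap M)) R)
    (P : probability (mapseq M) R) (nuP : is_power_measure nu P)
    (bdG : rho_diam (topsupport nu) < +oo)
    (wca : contraction_sum P < +oo)
    (eta : probability (borel M) R) (eta_stat : stationary nu eta)
    (h : M -> R) (lip_h : is_lipschitz h) :
  (forall (x : M) (n : nat) (t : R), (0 < n)%N ->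
     2%:E * contraction_sum P * (lipschitz_const h)%:E / n%:R%:E < t%:E ->
     P [set w | t < `|n%:R^-1 * birkhoff_sum h n x w - mean eta h|]%R <=
     2%:E * expeR (- ((n%:R * t ^+ 2)%:E /
       (48%:E * (lipschitz_const h)%:E ^+ 2 *
        (contraction_sum P + rho_diam (topsupport nu)) ^+ 2))))
  /\
  ereal_sup [set `|(n%:R^-1)%:E * 'E_P[birkhoff_sum h n x] - (mean eta h)%:E|
            | x in [set: M]] @[n --> \oo] --> 0.
Proof.
have [l lE] : exists l : R, contraction_sum P = l%:E.
  by exists (fine (contraction_sum P)); rewrite fineK// ge0_fin_numE ?contraction_sum_ge0.
have [r rE] : exists r : R, rho_diam (topsupport nu) = r%:E.
  exists (fine (rho_diam (topsupport nu))); rewrite fineK// ge0_fin_numE//.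
  exact: rho_diam_topsupport_ge0 eta_stat.
have l0 : (0 <= l)%R by rewrite -lee_fin -lE contraction_sum_ge0.
have r0 : (0 <= r)%R.
  by rewrite -lee_fin -rE; exact: rho_diam_topsupport_ge0 eta_stat.
have L0 := lipschitz_const_ge0 lip_h; set L := lipschitz_const h in L0 *.
have ch := lipschitz_continuous lip_h.
have hH z := lipschitz_bounded lip_h z lE.
set V := birkhoff_mean P h.
have osc n x y : (`|V n x - V n y| <= L * l)%R.
  exact: birkhoff_mean_osc.
have bias n x : (`|V n x - n%:R * mean eta h| <= L * l)%R.
  exact: (birkhoff_bias cptM nuP ch hH eta_stat).
have mS n x := measurable_birkhoff_sum_at cptM ch n x.
have scaled n x : (0 < n)%N ->
    (`|n%:R^-1 * V n x - mean eta h| <= L * l * n%:R^-1)%R.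
  move=> n0; rewrite -(@ler_pM2l _ n%:R) ?ltr0n//.
  have nn : (n%:R != 0 :> R)%R by rewrite pnatr_eq0 -lt0n.
  rewrite -[X in (X * `|_|)%R](@normr_nat R) -normrM mulrBr mulVKf//.
  by rewrite mulrCA mulfV// mulr1.
have EV n x : 'E_P[birkhoff_sum h n x] = (V n x)%:E.
  rewrite unlock /V /birkhoff_mean /Rintegral fineK//.
  apply: integrable_fin_num => //; apply: bounded_integrable; first exact: mS.
  by move=> w; exact: birkhoff_sum_bound.
split.
- move=> x n t n0; have n0R : (0 < n%:R :> R)%R by rewrite ltr0n.
  rewrite lE rE inver gt_eqF// -!EFinM lte_fin => ht.
  have t0 : (0 < t)%R by apply: le_lt_trans ht; rewrite !mulr_ge0 ?invr_ge0.
  (* [birkhoff_tail] needs a positive constant. If [L * l] vanishes then h is constant, since the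
     diameter of [M] is at most [l], and the event is empty. *)
  have [c0|c_neq0] := eqVneq (L * l)%R 0%R.
    rewrite (_ : [set w | _]%R = set0).
      by rewrite measure0 mule_ge0// expeR_ge0.
    apply/seteqP; split => // w /=.
    have hx z : h z = h x.
      apply/eqP; rewrite -subr_eq0 -normr_le0 -c0.
      apply: (le_trans (lipschitz_const_ub lip_h z x)).
      by rewrite ler_wpM2l// -lee_fin -lE mdist_contraction_sum.
    rewrite /birkhoff_sum (eq_bigr (fun=> h x)); last by move=> k _; exact: hx.
    rewrite sumr_const card_ord -[(h x *+ n)%R]mulr_natl mulKf ?lt0r_neq0//.
    rewrite /mean (@eq_Rintegral _ _ _ _ setT (fun=> h x)); last by move=> z _; exact: hx.
    by rewrite Rintegral_probability_cst subrr normr0 ltNge ltW.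
  have c0 : (0 < L * l)%R by rewrite lt_neqAle eq_sym c_neq0 mulr_ge0.
  have [Lpos lpos] : (0 < L)%R /\ (0 < l)%R.
    by move: c_neq0; rewrite mulf_eq0 negb_or => /andP[? ?];
      rewrite !lt0r; split; apply/andP.
  (* Half of the deviation n t pays for the bias, which is below [u] by the hypothesis on t; the
     other half is left to the tail bound. *)
  pose u := (n%:R * t / 2)%R.
  have u0 : (0 < u)%R by rewrite divr_gt0// mulr_gt0.
  have cu : (L * l < u)%R.
    move: ht; rewrite ltr_pdivrMr// => ht; rewrite /u; lra.
  apply: (@le_trans _ _ (P [set w | u <= `|birkhoff_sum h n x w - V n x|]%R)).
    apply: le_measure; rewrite ?inE.
    + rewrite -[X in measurable X]setTI.
      have mf : measurable_fun setT (fun w : mapseq M =>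
          `|n%:R^-1 * birkhoff_sum h n x w - mean eta h|)%R.
        apply: measurableT_comp => //; apply: measurable_funB => //.
        exact: measurable_funM.
      have := mf measurableT _ (measurable_itv `]t, +oo[%R).
      by congr (measurable (_ `&` _)); apply/seteqP; split => z /=; rewrite in_itv/= andbT.
    + rewrite -[X in measurable X]setTI.
      have mf : measurable_fun setT (fun w : mapseq M =>
          `|birkhoff_sum h n x w - V n x|)%R.
        by apply: measurableT_comp => //; exact: measurable_funB.
      have := mf measurableT _ (measurable_itv `[u, +oo[%R).
      by congr (measurable (_ `&` _)); apply/seteqP; split => z /=; rewrite in_itv/= andbT.
    + move=> w /= tw.
      set S := birkhoff_sum h n x w in tw *.
      have : (n%:R * t < `|S - n%:R * mean eta h|)%R.
        have -> : (S - n%:R * mean eta h = n%:R * (n%:R^-1 * S - mean eta h))%R.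
          by rewrite mulrBr mulVKf// lt0r_neq0.
        by rewrite normrM normr_nat ltr_pM2l.
      have := bias n x; have := ler_normD (S - V n x)%R (V n x - n%:R * mean eta h)%R.
      rewrite addrA subrK => h1 h2 h3; rewrite /u in cu *; lra.
  have tail := birkhoff_tail cptM nuP ch hH x osc c0 n0 u0.
  apply: le_trans tail _.
  have lr0 : (0 < l + r)%R by rewrite ltr_wpDr.
  rewrite inver gt_eqF; last by rewrite !mulr_gt0.
  rewrite lee_pmul2l// -EFinM lee_fin ler_expR lerN2.
  (* The choice of [u] gives the constant 32 and the factor [l]; the stated bound follows from 32 <=
     48 and l <= l + r. *)
  have -> : (u ^+ 2 / (8 * n%:R * (L * l) ^+ 2) =
      n%:R * t ^+ 2 / (32 * (L * l) ^+ 2))%R.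
    by rewrite /u; field; rewrite !lt0r_neq0.
  apply: ler_wpM2l; first by rewrite mulr_ge0// sqr_ge0.
  rewrite lef_pV2 ?posrE ?mulr_gt0 ?exprn_gt0//.
  have h1 : (L * l * (L * l) <= L * (l + r) * (L * (l + r)))%R.
    by apply: ler_pM; rewrite ?mulr_ge0// ler_wpM2l// lerDl.
  nra.
(* The supremum is squeezed between 0 and L l / n, the bias divided by n. *)
- have -> : (0 : \bar R) = 0%:E by [].
  apply: (@squeeze_cvge _ _ _ _ (fun=> 0) _ (fun n => (L * l * n%:R^-1)%:E)).
  + near=> n.
    have n0 : (0 < n)%N by near: n; exact: nbhs_infty_gt.
    apply/andP; split.
      by apply: ereal_sup_ge; eexists; [exists point|].
    apply: ge_ereal_sup => _ [x _ <-].
    rewrite EV -EFinM -EFinB lee_fin; exact: scaled.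
  + exact: cvg_cst.
  + apply: cvg_EFin; first by near=> n.
    (* The harmonic sequence is 1 / (n+1), hence the shift of index. *)
    rewrite -(@cvg_shiftS R^o).
    have := @cvgM R _ _ _ _ _ _ _ (cvg_cst (L * l)%R) (@cvg_harmonic R).
    by rewrite mulr0; apply.
Unshelve. all: by end_near.
Qed.
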